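(* Let $n\ge 5$ and let $H_n\cong K_{n-1}\cup K_1$ be the graph obtained from the complete graph $K_{n-1}$ by adding an isolated vertex. Then no orientation of $H_n$ is an oriented Riordan graph.
   Context: An orientation of a simple undirected graph assigns a direction to each edge, producing an oriented graph. The skew-adjacency matrix of an oriented graph $G^\sigma$ with respect to a labelling of its vertices by $1,\dots,n$ is $\mathcal{S}(G^\sigma)=[s_{i,j}]_{1\le i,j\le n}$ with $s_{i,j}=1$ and $s_{j,i}=-1$ if $i\to j$ is an arc, and $s_{i,j}=s_{j,i}=0$ if there is no arc between $i$ and $j$. An oriented graph on $n$ vertices is called an oriented Riordan graph if there exist a labelling $1,\dots,n$ of its vertices and formal power series $g,f\in\mathbb{Z}[[z]]$ with $f(0)=0$ such that, with respect to this labelling, $s_{i,j}\equiv[z^{i-2}]\,g f^{\,j-1}\pmod 3$ for all $n\ge i>j\ge1$. Here $[z^k]h$ denotes the coefficient of $z^k$ in $h$. *)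

(* Defs.v *)
From HB Require Import structures.
From mathcomp Require Import all_boot all_order all_algebra.

Set Implicit Arguments.
Unset Strict Implicit.
Unset Printing Implicit Defensive.

Import GRing.Theory.
Local Open Scope ring_scope.

Record sgraph (V : finType) := SGraph {
  adj :> rel V;
  adj_sym : symmetric adj;
  adj_irrefl : irreflexive adj }.

(* [arc_asym] at u = v also rules out loops. *)
Record ograph (V : finType) := OGraph {
  arc :> rel V;
  arc_asym : forall u v, arc u v -> ~~ arc v u }.

Definition is_orientation (V : finType) (G : sgraph V) (D : ograph V) : Prop :=
  forall u v, G u v = D u v || D v u.

Definition graph_iso (V W : finType) (G : sgraph V) (H : sgraph W) : Prop :=
  exists2 phi : V -> W, bijective phi & forall u v, H (phi u) (phi v) = G u v.

Definition complete_rel (n : nat) : rel 'I_n := fun u v => u != v.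

Lemma complete_rel_sym n : symmetric (@complete_rel n).
Proof. by move=> u v; rewrite /complete_rel eq_sym. Qed.

Lemma complete_rel_irrefl n : irreflexive (@complete_rel n).
Proof. by move=> u; rewrite /complete_rel eqxx. Qed.

Definition complete_graph (n : nat) : sgraph 'I_n :=
  SGraph (@complete_rel_sym n) (@complete_rel_irrefl n).

Definition union_rel (V W : finType) (G : sgraph V) (H : sgraph W) :
    rel (V + W)%type :=
  fun x y => match x, y with
    | inl u, inl v => G u v
    | inr u, inr v => H u v
    | _, _ => false
    end.

Lemma union_rel_sym (V W : finType) (G : sgraph V) (H : sgraph W) :
  symmetric (union_rel G H).
Proof. by move=> [u|u] [v|v] //=; apply: adj_sym. Qed.

Lemma union_rel_irrefl (V W : finType) (G : sgraph V) (H : sgraph W) :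
  irreflexive (union_rel G H).
Proof. by move=> [u|u] /=; apply: adj_irrefl. Qed.

Definition disjoint_union (V W : finType) (G : sgraph V) (H : sgraph W) :
    sgraph (V + W)%type :=
  SGraph (union_rel_sym G H) (union_rel_irrefl G H).

(* The vertex with (0-based) index i : 'I_n is the one labelled i + 1. *)
Definition skew_adjacency (V : finType) (D : ograph V) (n : nat)
    (lab : 'I_n -> V) : 'M[int]_n :=
  \matrix_(i, j) (if D (lab i) (lab j) then 1
                  else if D (lab j) (lab i) then -1 else 0).

(* Formal power series over the integers; h k is the coefficient of z^k in h. *)
Definition fps := nat -> int.

Definition fps_one : fps := fun k => (k == 0%N)%:Z.

Definition fps_mul (a b : fps) : fps :=
  fun k => \sum_(i < k.+1) a i * b (k - i)%N.

Definition fps_exp (a : fps) (m : nat) : fps := iter m (fps_mul a) fps_one.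

(* With 1-based labels I = i + 1 and J = j + 1, the coefficient
   [z^(I - 2)] g f^(J - 1) is that of z^(i - 1) in g f^j; here i > 0, as j < i. *)
Definition oriented_riordan (V : finType) (D : ograph V) : Prop :=
  exists lab : 'I_#|V| -> V, exists g f : fps,
    [/\ bijective lab, f 0%N = 0 &
        forall i j : 'I_#|V|, (j < i)%N ->
          (skew_adjacency D lab i j
             = fps_mul g (fps_exp f j) i.-1 %[mod 3])%Z].

(* Main.v *)
Require Import Defs.
From mathcomp Require Import all_boot all_order all_algebra.

(** The entries just below the diagonal are [z^j] g f^j = g_0 f_1^j.  The
    isolated vertex forces one of them to vanish mod 3, so g_0 or f_1 is 0 mod 3,
    and then all of them with j >= 1 vanish mod 3.  With at least five vertices,
    some two consecutive labels j, j + 1 with j >= 1 avoid the isolated vertex,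
    and the corresponding entry must be 1 or -1. *)

Set Implicit Arguments.
Unset Strict Implicit.
Unset Printing Implicit Defensive.

Import GRing.Theory.
Local Open Scope ring_scope.

(** Each factor [f] contributes at least one power of z. *)
Lemma fps_exp_below (f : fps) (j i : nat) :
  f 0%N = 0 -> (i < j)%N -> fps_exp f j i = 0.
Proof.
move=> f0; elim: j i => [|j IHj] i // ltij.
rewrite /fps_exp iterS -/(fps_exp f j) /fps_mul big_ord_recl f0 mul0r add0r.
apply: big1 => u _; rewrite IHj ?mulr0 //= /bump /= add1n.
have lt_ui := ltn_ord u.
by rewrite -(ltn_add2r u.+1) subnK // (leq_trans ltij) // addnS ltnS leq_addr.
Qed.

Lemma fps_mul_lead (g h : fps) (j : nat) :
  (forall i, (i < j)%N -> h i = 0) -> fps_mul g h j = g 0%N * h j.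
Proof.
move=> h0; rewrite /fps_mul big_ord_recl subn0 big1 ?addr0 // => u _.
by rewrite h0 ?mulr0 //= /bump /= add1n ltn_subrL /= (leq_ltn_trans _ (ltn_ord u)).
Qed.

Lemma fps_exp_lead (f : fps) (j : nat) :
  f 0%N = 0 -> fps_exp f j j = f 1%N ^+ j.
Proof.
move=> f0; elim: j => [|j IHj] //.
(* Only the term in [f 1] survives: later ones meet [fps_exp f j] below degree [j]. *)
rewrite /fps_exp iterS -/(fps_exp f j) /fps_mul !big_ord_recl f0 mul0r add0r.
rewrite big1 /= => [|u _]; first by rewrite addr0 subSS subn0 IHj exprS.
rewrite fps_exp_below ?mulr0 //= /bump /= !add1n subSS ltn_subrL /=.
exact: leq_ltn_trans (ltn_ord u).
Qed.

Lemma fps_riordan_subdiag (g f : fps) (j : nat) :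
  f 0%N = 0 -> fps_mul g (fps_exp f j) j = g 0%N * f 1%N ^+ j.
Proof.
by move=> f0; rewrite fps_mul_lead ?fps_exp_lead // => i; apply: fps_exp_below.
Qed.

Lemma skew_adjacency_dvd3 (V : finType) (H : sgraph V) (D : ograph V) (n : nat)
    (lab : 'I_n -> V) (i j : 'I_n) : is_orientation H D ->
  (3 %| skew_adjacency D lab i j)%Z = ~~ H (lab i) (lab j).
Proof. by move=> hD; rewrite mxE hD; case: ifP => //=; case: ifP. Qed.

(** The vertex [w] is the preimage of the unique vertex of the [complete_graph 1] summand. *)
Lemma isolated_vertex (n : nat) (V : finType) (H : sgraph V) :
  graph_iso H (disjoint_union (complete_graph n) (complete_graph 1)) ->
  #|V| = n.+1 /\
  exists w, forall u v, H u v = [&& u != v, u != w & v != w].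
Proof.
case=> phi phi_bij HE; split.
  by rewrite (bij_eq_card phi_bij) card_sum !card_ord addn1.
have phi_inj := bij_inj phi_bij; case: (phi_bij) => psi _ psiK.
exists (psi (inr ord0)) => u v.
rewrite -HE -!(inj_eq phi_inj) psiK.
case: (phi u) (phi v) => [a|a] [b|b] //=; rewrite ?ord1 ?eqxx ?andbF //.
by rewrite /complete_rel !andbT.
Qed.

(** By primality [p] divides [a] or [b], and [b] divides [b ^+ j] because [j] is positive; [i] may
    be 0. *)
Lemma dvd_mul_exp (p : nat) (a b : int) (i j : nat) :
  prime p -> (0 < j)%N -> (p %| a * b ^+ i)%Z -> (p %| a * b ^+ j)%Z.
Proof.
move=> p_pr j_gt0; rewrite !dvdzE !abszM !abszX !Euclid_dvdM // !Euclid_dvdX //.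
by rewrite j_gt0 andbT => /orP[->|/andP[-> _]]; rewrite ?orbT.
Qed.

Lemma consecutive_avoiding (n k : nat) : (5 <= n)%N ->
  exists j, [/\ (0 < j)%N, (j.+1 < n)%N, j != k & j.+1 != k].
Proof.
(* For [k = 2] the first available pair is 3, 4, whence the bound 5. *)
move=> n5; case: k => [|[|[|k]]]; [exists 1%N | exists 2 | exists 3 | exists 1%N];
  by split=> //; apply: leq_trans n5.
Qed.

Theorem proposition1p3 (n : nat) (hn : (5 <= n)%N) (V : finType) (H : sgraph V)
    (hH : graph_iso H (disjoint_union (complete_graph n.-1) (complete_graph 1)))
    (D : ograph V) (hD : is_orientation H D) :
  ~ oriented_riordan D.
Proof.
move=> [lab [g [f [lab_bij f0 LE]]]].
have [cardV [w HE]] := isolated_vertex hH.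
have {n hn hH cardV} V5 : (5 <= #|V|)%N.
  by rewrite cardV prednK // (leq_trans _ hn).
have [k labk] : exists k, lab k = w.
  by case: lab_bij => unlab _ labK; exists (unlab w).
(* The entry at [(j.+1, j)] vanishes mod 3 exactly when one of its two distinct vertices is the
   isolated one. *)
have subdiag (j : nat) : (j.+1 < #|V|)%N ->
  (3 %| g 0%N * f 1%N ^+ j)%Z = (j == k) || (j.+1 == k).
  move=> ltj; have E := LE (Ordinal ltj) (Ordinal (ltnW ltj)) (leqnn _).
  rewrite /= fps_riordan_subdiag // in E.
  rewrite (sameP dvdz_mod0P eqP) -E -(sameP dvdz_mod0P eqP).
  rewrite (skew_adjacency_dvd3 _ _ _ hD) HE -labk !(inj_eq (bij_inj lab_bij)).
  by rewrite -!val_eqE /= gtn_eqF ?leqnn //= negb_and !negbK orbC.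
(* Pair [k] with its predecessor, or with 1 when [k] is 0. *)
have [i /subdiag] : exists2 i, (i.+1 < #|V|)%N & (i == k) || (i.+1 == k).
  have ltk := ltn_ord k; case: (nat_of_ord k) ltk => [_|i lti].
    by exists 0%N; rewrite // (leq_trans _ V5).
  by exists i; rewrite ?eqxx ?orbT.
have [j [j_gt0 /subdiag + jk j1k]] := consecutive_avoiding k V5.
rewrite (negPf jk) (negPf j1k) => /negbT not3 <- i_k.
by case/negP: not3; apply: dvd_mul_exp j_gt0 i_k.
Qed.
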